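(* Let $k\geq 3$ be an odd integer. There exists a strictly Deza dihedrant with $8k$ vertices whose WL-rank equals $6k$. Explicitly, one may take $\Sigma(k)=\mathrm{Cay}(G,Z)$, where $G=\langle x,y:~x^{4k}=y^2=e,~yxy=x^{-1}\rangle$, $A_1=\langle x^4\rangle$, and $Z=x^2A_1\cup y(A_1\setminus\{x^{2(k-1)}\})\cup\{yx^{2k-1},yx^{-2},yx^{-1}\}$.
   Context: All graphs are finite, undirected, without loops and multiple edges. For $S\subseteq G$ with $e\notin S$, $S=S^{-1}$, $\mathrm{Cay}(G,S)$ has vertex set $G$ and edges $\{g,sg\}$. A dihedrant is a graph isomorphic to a Cayley graph over a dihedral group. A $k$-regular graph is a Deza graph if there are nonnegative integers $a,b$ such that every pair of distinct vertices has either $a$ or $b$ common neighbours; it is strictly Deza if moreover it is not strongly regular and has diameter $2$. The WL-rank of $\mathrm{Cay}(G,S)$ is the number of basic sets of the smallest S-ring over $G$ in which $S$ is a union of basic sets (equivalently, the rank of the coherent configuration generated by the graph). An S-ring over $G$ is a subring $\mathcal{A}$ of $\mathbb{Z}G$ spanned by elements $\underline{X}=\sum_{x\in X}x$, $X$ ranging over a partition $\mathcal{S}(\mathcal{A})$ of $G$ (the basic sets) with $\{e\}\in\mathcal{S}(\mathcal{A})$ and $X^{-1}\in\mathcal{S}(\mathcal{A})$ whenever $X\in\mathcal{S}(\mathcal{A})$. *)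

(* Defs.v *)
From HB Require Import structures.
From mathcomp Require Import all_boot all_order all_algebra all_fingroup.
From mathcomp Require Import all_solvable.

Set Implicit Arguments.
Unset Strict Implicit.
Unset Printing Implicit Defensive.

Import GRing.Theory.

Section Graphs.

Variable T : finType.
Implicit Types (E : rel T) (u v : T).

Definition is_graph E : Prop := symmetric E /\ irreflexive E.

Definition regular E (k : nat) : Prop := forall v, #|[set w | E v w]| = k.

Definition common_nbrs E u v : nat := #|[set w | E u w && E v w]|.

Definition deza E : Prop :=
  is_graph E /\
  exists k a b : nat, regular E k /\
    forall u v, u != v -> common_nbrs E u v = a \/ common_nbrs E u v = b.

(* Complete and edgeless graphs are not excluded here; some authors do so, but
   in [strictly_deza] they are ruled out by the diameter anyway. *)
Definition strongly_regular E : Prop :=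
  is_graph E /\
  exists k lambda mu : nat,
    [/\ regular E k,
        forall u v, E u v -> common_nbrs E u v = lambda &
        forall u v, u != v -> ~~ E u v -> common_nbrs E u v = mu].

Definition walk E u v (d : nat) : Prop :=
  exists p : seq T, [/\ path E u p, last u p = v & size p = d].

Definition distance E u v (d : nat) : Prop :=
  walk E u v d /\ forall d', walk E u v d' -> d <= d'.

Definition has_diameter E (d : nat) : Prop :=
  (forall u v, exists2 d', distance E u v d' & d' <= d) /\
  (exists u v, distance E u v d).

Definition strictly_deza E : Prop :=
  [/\ deza E, ~ strongly_regular E & has_diameter E 2].

End Graphs.

Definition graph_iso (T U : finType) (E : rel T) (F : rel U) : Prop :=
  exists2 f : T -> U, bijective f & forall u v, F (f u) (f v) = E u v.

Section Cayley.

Local Open Scope group_scope.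

Variable gT : finGroupType.
Implicit Types (S : {set gT}) (x y : gT).

Definition connection_set S : Prop := 1 \notin S /\ S = S^-1.

(* [S :* g] is the right coset of all products [s * g] with [s \in S]. *)
Definition cay S : rel gT := fun g h => h \in S :* g.

(* By the semantics of [\isog Grp], the group is isomorphic to the presented
   one; as that group is finite, any generators [x], [y] of [gT] satisfying the
   relations correspond to the presentation's own generators. *)
Definition dihedral_generators (n : nat) x y : Prop :=
  [/\ [set: gT] \isog Grp (a : b : a ^+ n, b ^+ 2, b * a * b = a^-1),
      <<[set x; y]>> = [set: gT],
      x ^+ n = 1, y ^+ 2 = 1 & y * x * y = x^-1].

Definition dihedral_group : Prop :=
  exists (n : nat) (x y : gT), 0 < n /\ dihedral_generators n x y.

Definition sigma_set (k : nat) x y : {set gT} :=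
  let A1 : {set gT} := <[x ^+ 4]> in
  x ^+ 2 *: A1 :|: y *: (A1 :\ x ^+ (2 * (k - 1))%N)
    :|: [set y * x ^+ (2 * k - 1)%N; y * x ^- 2; y * x^-1].

End Cayley.

Definition dihedrant (T : finType) (E : rel T) : Prop :=
  exists (gT : finGroupType) (S : {set gT}),
    [/\ dihedral_group gT, connection_set S & graph_iso E (cay S)].

(* The integral group ring, an element being its family of coefficients. *)
Definition group_ring (gT : finGroupType) : Type := {ffun gT -> int}.

Section GroupRing.

Local Open Scope ring_scope.

Variable gT : finGroupType.
Local Notation ZG := (group_ring gT).
Implicit Types (a b c : ZG) (X : {set gT}).

HB.instance Definition _ := GRing.Zmodule.copy ZG {ffun gT -> int}.

Definition gsum X : ZG := [ffun g => (g \in X : nat)%:Z].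

Definition gr_mul a b : ZG := [ffun g => \sum_h a h * b (h^-1 * g)%g].

Lemma gr_mulA : associative gr_mul.
Proof.
move=> a b c; apply/ffunP=> g; rewrite !ffunE.
under eq_bigr => h _ do rewrite ffunE mulr_sumr.
under [RHS]eq_bigr => h _ do rewrite ffunE mulr_suml.
rewrite [RHS]exchange_big /=; apply: eq_bigr => h _.
rewrite [RHS](reindex_inj (mulgI h)) /=; apply: eq_bigr => j _.
by rewrite mulKg invMg !mulgA mulrA.
Qed.

Lemma gr_mul1 : left_id (gsum [set 1%g]) gr_mul.
Proof.
move=> a; apply/ffunP=> g; rewrite ffunE (bigD1 1%g) //= big1 => [|h h1].
  by rewrite ffunE set11 mul1r invg1 mul1g addr0.
by rewrite ffunE inE (negPf h1) mul0r.
Qed.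

Lemma gr_mulr1 : right_id (gsum [set 1%g]) gr_mul.
Proof.
move=> a; apply/ffunP=> g; rewrite ffunE (bigD1 g) //= big1 => [|h hg].
  by rewrite ffunE mulVg set11 mulr1 addr0.
rewrite ffunE inE -(inj_eq (mulgI h)) mulKVg mulg1 eq_sym (negPf hg).
by rewrite mulr0.
Qed.

Lemma gr_mulDl : left_distributive gr_mul +%R.
Proof.
move=> a b c; apply/ffunP=> g; rewrite !ffunE -big_split /=.
by apply: eq_bigr => h _; rewrite ffunE mulrDl.
Qed.

Lemma gr_mulDr : right_distributive gr_mul +%R.
Proof.
move=> a b c; apply/ffunP=> g; rewrite !ffunE -big_split /=.
by apply: eq_bigr => h _; rewrite ffunE mulrDr.
Qed.

HB.instance Definition _ := GRing.Zmodule_isPzRing.Build ZG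
  gr_mulA gr_mul1 gr_mulr1 gr_mulDl gr_mulDr.

Definition is_subring (A : ZG -> Prop) : Prop :=
  [/\ A 1, forall a b, A a -> A b -> A (a - b) &
      forall a b, A a -> A b -> A (a * b)].

Definition zspan (P : {set {set gT}}) : ZG -> Prop := fun a =>
  exists c : {set gT} -> int, a = \sum_(X in P) gsum X *~ c X.

End GroupRing.

Section SRings.

Variable gT : finGroupType.
Implicit Types (P Q : {set {set gT}}) (S : {set gT}).

(* An S-ring is represented by its partition into basic sets; the ring itself
   is [zspan P]. *)
Definition is_sring P : Prop :=
  [/\ partition P [set: gT], [set 1%g] \in P,
      forall X, X \in P -> (X^-1)%g \in P & is_subring (zspan P)].

Definition union_of_basic S P : Prop := exists2 Q : {set {set gT}}, Q \subset P & S = cover Q.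

Definition wl_closure S P : Prop :=
  [/\ is_sring P, union_of_basic S P &
      forall Q, is_sring Q -> union_of_basic S Q ->
        forall a, zspan P a -> zspan Q a].

(* The smallest S-ring is unique, so at most one [r] satisfies this. *)
Definition wl_rank S (r : nat) : Prop := exists2 P : {set {set gT}}, wl_closure S P & #|P| = r.

End SRings.

(* Main.v *)
Require Import Defs.
From mathcomp Require Import all_boot all_order all_algebra all_fingroup.
From mathcomp Require Import all_solvable zify ssrAC.

(* Put c = x^(2k), t = y x^-2, A = <x^4> and U = A u tA.  The connection set
   can be rewritten as Z = (cU \ {tc}) u {t, tx, txc}, and in the group ring
     Z^2 = 4 + (2k - 4) U + 2 G,
   so the numbers of common neighbours are 2k - 2 and 2.  In any S-ring
   containing Z, the only element of Z with coefficient 2k - 2 in Z^2 is t, so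
   {t} is a basic set; then t Z - Z t = {x, xc} - {x^-1, x^-1 c} isolates
   {x, xc}, whose square meets Z in {x^2}.  Hence the S-ring contains all
   orbits of the involutive automorphism that fixes H = <x^2, t> pointwise and
   multiplies the other elements by c.  Those orbits do form an S-ring, with
   4k singletons and 2k pairs. *)

Set Implicit Arguments.
Unset Strict Implicit.
Unset Printing Implicit Defensive.

Import GRing.Theory Num.Theory.

(** * Dihedral presentations compared with the library group ['D_(n.*2)] *)

Section Presentation.

Local Open Scope group_scope.

(** The relation [b ^+ 2] forces [b^-1 = b], so [b * a * b] is the conjugate [a ^ b]. This makes the
    known facts on ['D_(n.*2)] available. *)
Lemma dihedral_presentationE (rT : finGroupType) (H : {group rT}) n :
  (H \homg Grp (a : b : a ^+ n, b ^+ 2, b * a * b = a^-1)) =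
  (H \homg Grp (a : b : a ^+ n, b ^+ 2, a ^ b = a^-1)).
Proof.
apply: eq_existsb => -[a b] /=; rewrite !xpair_eqE.
case: (b ^+ 2 =P 1) => [b2|]; last by rewrite !andbF.
have /eqP b_inv : b^-1 == b by rewrite eq_invg_mul; apply/eqP.
by rewrite conjgE b_inv mulgA.
Qed.

Lemma dihedral_isog n (gT : finGroupType) : 1 < n ->
  ([set: gT] \isog Grp (a : b : a ^+ n, b ^+ 2, b * a * b = a^-1)) ->
  [set: gT] \isog 'D_(n.*2).
Proof.
move=> n_gt1 isoG; have isoD := Grp_dihedral n_gt1.
rewrite isogEhom; apply/andP; split.
  by rewrite isoD -dihedral_presentationE; apply: isoGrp_hom isoG.
by rewrite isoG dihedral_presentationE; apply: isoGrp_hom isoD.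
Qed.

Lemma card_dihedral_generators n (gT : finGroupType) (x y : gT) :
  1 < n -> dihedral_generators n x y -> #|gT| = n.*2.
Proof.
move=> n_gt1 [isoG _ _ _ _].
rewrite -cardsT (card_isog (dihedral_isog n_gt1 isoG)).
by rewrite (card_dihedral n_gt1).
Qed.

Lemma exists_dihedral_generators n : 1 < n ->
  exists (gT : finGroupType) (x y : gT), dihedral_generators n x y.
Proof.
move=> n_gt1; have isoD := Grp_dihedral n_gt1.
have isoD' : 'D_(n.*2) \isog Grp (a : b : a ^+ n, b ^+ 2, b * a * b = a^-1).
  by move=> rT H; rewrite isoD -dihedral_presentationE.
case/existsP: (isoGrp_hom isoD') => -[x y] /=.
rewrite !xpair_eqE => /and4P[/eqP genD /eqP xn /eqP y2 /eqP yxy].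
exists _, x, y; split=> //.
by rewrite -genD joing_idl joing_idr.
Qed.

End Presentation.

(** * Coefficients and products in the integral group ring; spans of partitions *)

Section GroupRingTheory.

Local Open Scope ring_scope.

Variable gT : finGroupType.
Implicit Types (a b : group_ring gT) (g h : gT) (X Y : {set gT}).
Implicit Types (P Q : {set {set gT}}).

Lemma gsumE X g : gsum X g = (g \in X : nat)%:Z.
Proof. by rewrite ffunE. Qed.

Lemma gr_addE a b g : (a + b) g = a g + b g.
Proof. exact: ffunE. Qed.

Lemma gr_oppE a g : (- a) g = - a g.
Proof. exact: ffunE. Qed.

Lemma gr_mulrnE a n g : (a *+ n) g = a g *+ n.
Proof. by elim: n => [|n IHn]; rewrite ?mulr0n ?ffunE // !mulrS gr_addE IHn. Qed.

Lemma gr_mulE a b g : (a * b) g = \sum_h a h * b (h^-1 * g)%g.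
Proof. exact: ffunE. Qed.

(** A common neighbour [w] amounts to a factorization of [v * u^-1] as [v * w^-1] times [w * u^-1]
    with both factors in [X]; the coefficient of the square counts these. *)
Lemma common_nbrs_cay X u v : X = (X^-1)%g ->
  (common_nbrs (cay X) u v)%:Z = (gsum X * gsum X) (v * u^-1)%g.
Proof.
move=> symX; rewrite /common_nbrs -sum1_card -natz natr_sum big_mkcond /=.
rewrite gr_mulE (reindex_inj invg_inj) (reindex_inj (mulgI v^-1)%g) /=.
apply: eq_bigr => w _; rewrite inE /cay !mem_rcoset !gsumE.
rewrite !invMg !invgK !mulgA mulgK -[(w^-1)%g \in X]mem_invg -symX.
by case: (_ \in X); case: (_ \in X).
Qed.

Lemma gsumU X Y : [disjoint X & Y] -> gsum (X :|: Y) = gsum X + gsum Y.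
Proof.
move=> /pred0P disXY; apply/ffunP=> g; rewrite gr_addE !gsumE inE.
by have /= := disXY g; case: (g \in X); case: (g \in Y).
Qed.

Lemma gsum2 g h : g != h -> gsum [set g; h] = gsum [set g] + gsum [set h].
Proof. by move=> g_h; rewrite gsumU // disjoints1 inE. Qed.

Lemma gsumD1 X g : g \in X -> gsum (X :\ g) = gsum X - gsum [set g].
Proof.
move=> Xg; apply/ffunP=> h; rewrite gr_addE gr_oppE !gsumE !inE.
by case: eqP => [->|_]; rewrite ?Xg //= subr0.
Qed.

Lemma gsum_mulCl g X : gsum [set g] * gsum X = gsum (g *: X)%g.
Proof.
apply/ffunP=> h; rewrite gr_mulE (bigD1 g) //= big1 => [|i i_g].
  by rewrite !gsumE set11 mul1r addr0 mem_lcoset.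
by rewrite gsumE inE (negPf i_g) mul0r.
Qed.

Lemma gsum_mulCr g X : gsum X * gsum [set g] = gsum (X :* g)%g.
Proof.
apply/ffunP=> h; rewrite gr_mulE (bigD1 (h * g^-1)%g) //= big1 => [|i i_g].
  by rewrite !gsumE invMg invgK mulgKV set11 mulr1 addr0 mem_rcoset.
rewrite !gsumE inE; case: eqP => [def_g|_]; last by rewrite mulr0.
by case/eqP: i_g; rewrite -def_g invMg invgK mulKVg.
Qed.

Lemma gsum_mul11 g h : gsum [set g] * gsum [set h] = gsum [set (g * h)%g].
Proof. by rewrite gsum_mulCl mulg_set1. Qed.

Lemma gsum_sqr_group (A : {group gT}) : gsum A * gsum A = gsum A *+ #|A|.
Proof.
apply/ffunP=> h; rewrite gr_mulE gr_mulrnE.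
under eq_bigr do rewrite !gsumE.
rewrite (bigID (mem A)) /= [X in _ + X]big1 ?addr0; last first.
  by move=> i /negPf->; rewrite mul0r.
rewrite -sumr_const; apply: eq_bigr => i Ai.
by rewrite Ai mul1r gsumE groupMl ?groupV.
Qed.

Lemma zspanE Q (c : {set gT} -> int) g : partition Q [set: gT] ->
  (\sum_(X in Q) gsum X *~ c X) g = c (pblock Q g).
Proof.
move=> /and3P[/eqP covQ tiQ _].
have Qg : pblock Q g \in Q by rewrite pblock_mem // covQ inE.
have mulzE a n : (a *~ n) g = a g * n.
  case: n => n; first by rewrite -pmulrn gr_mulrnE -mulr_natr natz.
  by rewrite NegzE mulrNz -pmulrn gr_oppE gr_mulrnE -mulr_natr mulrN natz.
rewrite sum_ffunE (bigD1 _ Qg) /= big1 => [|X /andP[QX neX]].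
  by rewrite mulzE gsumE mem_pblock covQ inE mul1r addr0.
rewrite mulzE gsumE; case: (boolP (g \in X)) => [gX|]; last by rewrite mul0r.
by case/eqP: neX; rewrite (def_pblock tiQ QX gX).
Qed.

(** Turns membership in the span into a condition on coefficients, the form in which S-rings are
    handled below. *)
Lemma zspanP Q a : partition Q [set: gT] ->
  zspan Q a <-> (forall g h, pblock Q g = pblock Q h -> a g = a h).
Proof.
move=> partQ; split=> [[c ->] g h eq_gh|const_a]; first by rewrite !zspanE ?eq_gh.
(* The coefficient of a block is read off at its representative; constancy makes the choice
   harmless. *)
exists (fun X => a (repr X)); apply/ffunP=> g; rewrite zspanE //.
have /and3P[/eqP covQ tiQ _] := partQ.
have gQ : g \in pblock Q g by rewrite mem_pblock covQ inE.
apply: const_a; apply/esym/def_pblock; rewrite ?pblock_mem ?covQ ?inE //.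
exact: mem_repr gQ.
Qed.

End GroupRingTheory.

(** * Producing elements of a given S-ring *)

Section SRingTheory.

Local Open Scope ring_scope.

Variables (gT : finGroupType) (Q : {set {set gT}}).
Hypothesis Q_sring : is_sring Q.
Implicit Types (a b : group_ring gT) (g h : gT) (X : {set gT}).

Let partQ : partition Q [set: gT]. Proof. by case: Q_sring. Qed.

Lemma sringB a b : zspan Q a -> zspan Q b -> zspan Q (a - b).
Proof. by case: Q_sring => _ _ _ [_ + _]; apply. Qed.

Lemma sringM a b : zspan Q a -> zspan Q b -> zspan Q (a * b).
Proof. by case: Q_sring => _ _ _ [_ _]; apply. Qed.

(** The Schur-Wielandt principle for two elements at once: both are constant on basic sets, hence so
    is the indicator of a joint level set. It isolates [{t}], [{x, xc}] and [{x^2}] later. *)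
Lemma sring_level a b (m n : int) X :
    zspan Q a -> zspan Q b -> (forall g, (g \in X) = (a g == m) && (b g == n)) ->
  zspan Q (gsum X).
Proof.
rewrite !zspanP // => Qa Qb defX g h eq_gh.
by rewrite !gsumE !defX (Qa _ _ eq_gh) (Qb _ _ eq_gh).
Qed.

Lemma sring_union X : union_of_basic X Q -> zspan Q (gsum X).
Proof.
move=> [B sBQ ->]; rewrite zspanP // => g h eq_gh; rewrite !gsumE.
have /and3P[/eqP covQ tiQ _] := partQ.
have memB i : (i \in cover B) = (pblock Q i \in B).
  apply/bigcupP/idP => [[Y BY iY]|Bi].
    by rewrite (def_pblock tiQ _ iY) // (subsetP sBQ).
  by exists (pblock Q i); rewrite // mem_pblock covQ inE.
by rewrite !memB eq_gh.
Qed.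

(** In a finite group every element of the generated subgroup is a product of generators, and
    products of singletons are singletons. *)
Lemma sring_gen1 X g :
    (forall h, h \in X -> zspan Q (gsum [set h])) ->
  g \in <<X>>%g -> zspan Q (gsum [set g]).
Proof.
move=> QX /gen_prodgP[n [s Xs ->]].
elim/big_ind: _ => [|h i Qh Qi|i _]; last exact: QX.
- by case: Q_sring => _ _ _ [].
- by rewrite -gsum_mul11; apply: sringM.
Qed.

End SRingTheory.

(** * The S-ring of orbits of an involutive automorphism *)

Section Twist.

Local Open Scope group_scope.

Variables (gT : finGroupType) (H : {group gT}) (c : gT).
Hypotheses (c_central : forall g, g * c = c * g) (c2 : c * c = 1) (Hc : c \in H).
Hypothesis c_neq1 : c != 1.
(** Expresses that [H] has index at most two, in the form used for multiplication. *)
Hypothesis H_index2 : forall g h, g \notin H -> h \notin H -> g * h \in H.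
Implicit Types (g h : gT) (a b : group_ring gT).

Definition twist g := if g \in H then g else g * c.

Definition twist_orbit g : {set gT} := [set g; twist g].

Definition twist_partition : {set {set gT}} := twist_orbit @: [set: gT].

Lemma mem_twist g : (twist g \in H) = (g \in H).
Proof. by rewrite /twist; case: ifP => // gH; rewrite groupMr. Qed.

Lemma twistK : involutive twist.
Proof.
move=> g; have := mem_twist g; rewrite /twist.
case: ifP => /= [gH _|gH ->]; first by rewrite gH.
by rewrite -mulgA c2 mulg1.
Qed.

(** When both factors lie outside [H], their product lies in [H] and the two copies of the central
    element [c] cancel. *)
Lemma twistM g h : twist (g * h) = twist g * twist h.
Proof.
rewrite /twist; case: (boolP (g \in H)) => gH.
  by rewrite groupMl //; case: ifP; rewrite ?mulgA.
case: (boolP (h \in H)) => hH; first by rewrite groupMr // (negPf gH) -!mulgA c_central.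
by rewrite H_index2 // mulgA -(mulgA g) -c_central mulgA -mulgA c2 mulg1.
Qed.

Lemma twist1 : twist 1 = 1.
Proof. by rewrite /twist group1. Qed.

Lemma twistV g : twist g^-1 = (twist g)^-1.
Proof. by apply/eqP; rewrite eq_sym eq_invg_mul -twistM mulgV twist1. Qed.

Lemma twist_orbit_eqP g h :
  reflect (twist_orbit g = twist_orbit h) (h \in twist_orbit g).
Proof.
apply: (iffP idP) => [|->]; last by rewrite set21.
by case/set2P => ->; rewrite // /twist_orbit twistK setUC.
Qed.

Lemma twist_partitionP : partition twist_partition [set: gT].
Proof.
apply/and3P; split.
- apply/eqP/setP => g; rewrite inE; apply/bigcupP.
  by exists (twist_orbit g); rewrite ?imset_f ?inE // eqxx.
- apply/trivIsetP => _ _ /imsetP[g _ ->] /imsetP[h _ ->].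
  apply: contraR => /pred0Pn[i /andP[/= /twist_orbit_eqP-> /twist_orbit_eqP->]].
  by [].
- by apply/imsetP => -[g _ /setP/(_ g)]; rewrite !inE eqxx.
Qed.

Lemma pblock_twist g : pblock twist_partition g = twist_orbit g.
Proof.
have /and3P[_ tiP _] := twist_partitionP.
by apply: def_pblock; rewrite ?imset_f ?inE ?eqxx.
Qed.

(** The span is the fixed ring of [twist], so its closure under products follows from [twistM]. *)
Lemma zspan_twistP a : zspan twist_partition a <-> forall g, a (twist g) = a g.
Proof.
rewrite zspanP; last exact: twist_partitionP.
split=> [inv_a g | inv_a g h].
  apply: inv_a; rewrite !pblock_twist; apply/esym/twist_orbit_eqP.
  by rewrite set22.
by rewrite !pblock_twist => /twist_orbit_eqP/set2P[] ->.
Qed.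

Lemma twist_partition_sring : is_sring twist_partition.
Proof.
split; first exact: twist_partitionP.
- by apply/imsetP; exists 1; rewrite ?inE // /twist_orbit twist1 setUid.
- move=> _ /imsetP[g _ ->]; apply/imsetP; exists g^-1; rewrite ?inE //.
  apply/setP=> h; rewrite !inE twistV.
  by rewrite -!(inj_eq invg_inj h^-1) !invgK.
split.
- apply/zspan_twistP => g; rewrite [in LHS]gsumE gsumE !inE.
  by rewrite -{1}twist1 (inj_eq (inv_inj twistK)).
- move=> a b /zspan_twistP inv_a /zspan_twistP inv_b; apply/zspan_twistP => g.
  by rewrite !gr_addE !gr_oppE inv_a inv_b.
- move=> a b /zspan_twistP inv_a /zspan_twistP inv_b; apply/zspan_twistP => g.
  rewrite !gr_mulE (reindex_inj (inv_inj twistK)) /=.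
  by apply: eq_bigr => h _; rewrite -twistV -twistM inv_a inv_b.
Qed.

Lemma union_of_basic_twist (X : {set gT}) :
  (forall g, g \in X -> twist g \in X) -> union_of_basic X twist_partition.
Proof.
move=> inv_X; exists (twist_orbit @: X); first exact/imsetS/subsetT.
apply/setP=> g; apply/idP/bigcupP => [Xg|[_ /imsetP[h Xh ->]]].
  by exists (twist_orbit g); rewrite ?imset_f // set21.
by case/set2P => -> //; apply: inv_X.
Qed.

(** Orbits are singletons on [H] and pairs elsewhere, so twice their number is the sum of their
    sizes plus one for each singleton. *)
Lemma card_twist_partition : (#|twist_partition| * 2 = #|gT| + #|H|)%N.
Proof.
have /card_partition := twist_partitionP; rewrite cardsT => ->.
pose P1 := [set [set h] | h in H].
have sP1 : P1 \subset twist_partition.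
  apply/subsetP=> _ /imsetP[h Hh ->]; apply/imsetP; exists h; rewrite ?inE //.
  by rewrite /twist_orbit /twist Hh setUid.
have <- : #|P1| = #|H| by apply/card_imset/set1_inj.
rewrite (big_setID P1) /= (setIidPr sP1) -sum1_card.
rewrite [LHS]mulnC big_distrr (big_setID P1) /= (setIidPr sP1) addnAC.
congr (_ + _)%N; last first.
  apply: eq_bigr => _ /setDP[/imsetP[g _ ->] nP1].
  case: (boolP (g \in H)) => Hg.
    by case/imsetP: nP1; exists g; rewrite // /twist_orbit /twist Hg setUid.
  rewrite cards2 /twist (negPf Hg) -[X in X == _]mulg1.
  by rewrite (inj_eq (mulgI g)) eq_sym c_neq1.
rewrite -sum1_card -big_split /=; apply: eq_bigr => _ /imsetP[h _ ->].
by rewrite cards1.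
Qed.

(** For [g] outside [H], the element [g * x^-1] lies in [H] and carries [{x, xc}] to the orbit of
    [g]. Thus all orbit sums lie in the span of [Q], and every block of [Q] lies inside an orbit. *)
Lemma twist_minimal (Q : {set {set gT}}) x : is_sring Q ->
    (forall h, h \in H -> zspan Q (gsum [set h])) ->
    x \notin H -> zspan Q (gsum [set x; x * c]) ->
  forall a, zspan twist_partition a -> zspan Q a.
Proof.
move=> Q_sring QH Hx Qx a /zspan_twistP inv_a.
have partQ : partition Q [set: gT] by case: Q_sring.
apply/zspanP => // g h eq_gh; case: (boolP (g \in H)) => Hg.
  have /zspanP/(_ g h eq_gh) := QH g Hg; move/(_ partQ); rewrite !gsumE set11 inE.
  by case: eqP => [->|].
have Hgx : g * x^-1 \in H by rewrite H_index2 ?groupV.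
have := sringM Q_sring (QH _ Hgx) Qx.
have -> : (gsum [set g * x^-1]%g * gsum [set x; x * c]%g)%R = gsum (twist_orbit g).
  rewrite gsum_mulCl /twist_orbit /twist (negPf Hg); congr (gsum _).
  by rewrite mulgU !mulg_set1 mulgA mulgKV.
move/zspanP => /(_ partQ g h eq_gh); rewrite !gsumE set21.
by case: (boolP (h \in _)) => // /set2P[]->; rewrite ?inv_a.
Qed.

End Twist.

(** * The square of the connection set as an abstract ring identity *)

Section SquareIdentity.

Local Open Scope ring_scope.

Variables (R : pzRingType) (u t s c w : R) (m : nat).
Hypotheses (uc : u * c = c * u) (tc : t * c = c * t) (sc : s * c = c * s).
Hypotheses (cc : c * c = 1) (tt : t * t = 1) (ss : s * s = 1).
Hypotheses (uu : u * u = u *+ m) (ut : u * t = u) (tu : t * u = u).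
Hypotheses (us : u * s * (1 + c) = w) (su : s * u * (1 + c) = w).

(** Read [u], [s], [w] as the sums of [U], [{tx}] and the complement of [H]. The factors [p = 1 + c]
    and [q = 1 - c] commute with [u], [t], [s] and satisfy [pp = 2p], [qq = 2q], [pq = 0], so the
    mixed products of [tq] and [sp] vanish. *)
Lemma square_identity :
  let z := u * c + t * (1 - c) + s * (1 + c) in
  z * z = u *+ m - (u * (1 - c)) *+ 2 + w *+ 2 + 4%:R.
Proof.
pose p := 1 + c; pose q := 1 - c; rewrite /= -/p -/q.
have usp : u * s * p = w by []; have sup : s * u * p = w by [].
have cp : c * p = p by rewrite mulrDr mulr1 cc addrC.
have cq : c * q = - q by rewrite mulrBr mulr1 cc opprB.
have pc : p * c = p by rewrite mulrDl mul1r cc addrC.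
have qc : q * c = - q by rewrite mulrBl mul1r cc opprB.
have commp (a : R) : a * c = c * a -> p * a = a * p.
  by move=> ac; rewrite mulrDl mulrDr mul1r mulr1 ac.
have commq (a : R) : a * c = c * a -> q * a = a * q.
  by move=> ac; rewrite mulrBl mulrBr mul1r mulr1 ac.
have pp : p * p = p *+ 2 by rewrite {1}/p mulrDl mul1r cp.
have qq : q * q = q *+ 2 by rewrite {1}/q mulrBl mul1r cq opprK.
have qp : q * p = 0 by rewrite {1}/q mulrBl mul1r cp subrr.
have pq : p * q = 0 by rewrite {1}/p mulrDl mul1r cq subrr.
have swap (a b d e : R) : b * d = d * b -> (a * b) * (d * e) = (a * d) * (b * e).
  by move=> bd; rewrite -!mulrA (mulrA b) bd !mulrA.
have qDp : q + p = 2%:R by rewrite /p /q addrACA addNr addr0.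
clearbody p q; rewrite !mulrDl !mulrDr.
rewrite (swap u c u c) // uu cc mulr1.
rewrite (swap u c t q) // ut cq (swap u c s p) // cp usp.
rewrite (swap t q u c (commq u uc)) tu qc (swap t q t q (commq t tc)) tt qq mul1r.
rewrite (swap t q s p (commq s sc)) qp mulr0 (swap s p u c (commp u uc)) pc sup.
rewrite (swap s p t q (commp t tc)) pq mulr0 (swap s p s p (commp s sc)) ss pp mul1r.
rewrite !mulrN !addr0.
(* Seven of the nine products survive: [uu], two copies of [-uq], two of [w], and [2q + 2p], which
   equals 4. *)
rewrite [LHS](AC (3*2*2) (1*(2*4)*(3*6)*(5*7))) /= -mulrnDl qDp -mulrnA.
by rewrite -opprD -!mulr2n.
Qed.

End SquareIdentity.

(** * Cosets of a subgroup of index two *)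

Section Index2.

Local Open Scope group_scope.

Variables (gT : finGroupType) (K L : {group gT}) (g : gT).
Hypotheses (sKL : K \subset L) (Lg : g \in L) (Kg : g \notin K).
Hypothesis oL : #|L| = (#|K| * 2)%N.

Lemma index2_coset : g *: K = L :\: K.
Proof.
apply/eqP; rewrite eqEcard card_lcoset cardsD (setIidPr sKL) oL.
rewrite muln2 -addnn addnK leqnn andbT.
apply/subsetP=> _ /lcosetP[h Kh ->]; rewrite inE groupMr // Kg groupM //.
exact: subsetP Kh.
Qed.

Lemma index2_rcoset : K :* g = L :\: K.
Proof.
apply/eqP; rewrite eqEcard card_rcoset cardsD (setIidPr sKL) oL.
rewrite muln2 -addnn addnK leqnn andbT.
apply/subsetP=> _ /rcosetP[h Kh ->]; rewrite inE groupMl // Kg groupM //.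
exact: subsetP Kh.
Qed.

Lemma index2_cover : L = K :|: g *: K :> {set gT}.
Proof.
apply/setP=> h; rewrite index2_coset !inE.
by case: (boolP (h \in K)) => // /(subsetP sKL).
Qed.

End Index2.

(** The booleans stand for membership of one group element in [{1}], [U], [cU] and [H]. Positivity
    of [k] makes the truncated [2 * k - 2] agree with the integer difference. *)
Lemma deza_coef_arith (k : nat) (e u v h : bool) :
    0 < k -> (e -> u) -> (u -> ~~ v) -> h = u || v ->
  ((u : nat)%:Z *+ (2 * k) - ((u : nat)%:Z - (v : nat)%:Z) *+ 2
     + (~~ h : nat)%:Z *+ 2 + (e : nat)%:Z *+ 4 =
  (if e then 2 * k + 2 else if u then 2 * k - 2 else 2)%N%:Z)%R.
Proof.
have mulnE (z : int) n : (z *+ n = z * n%:Z)%R by rewrite -mulr_natr natz.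
rewrite !mulnE => k_gt0; case: e u v => [] [] [] // H1 H2 -> /=.
all: by [have := H1 isT | have := H2 isT | move: k_gt0; clear; lia].
Qed.

(** * The connection set described through [U], [H], [c], [t] and [x], and its square *)

Section DezaSet.

Local Open Scope group_scope.

Variables (k : nat) (gT : finGroupType) (U H : {group gT}) (c t x : gT).
Hypotheses (k_ge3 : 2 < k) (c_central : forall g, g * c = c * g).
Hypotheses (cc : c * c = 1) (tt : t * t = 1) (xt : x * t = t * x^-1).
Hypotheses (sUH : U \subset H) (Ut : t \in U) (Hc : c \in H) (Uc : c \notin U).
Hypotheses (Hx : x \notin H) (cx2 : c * x ^+ 2 \in U).
Hypotheses (t_neq1 : t != 1) (x2_neq1 : x ^+ 2 != 1).
Hypotheses (x2_c : x ^+ 2 != c) (x2_tc : x ^+ 2 != t * c).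
Hypotheses (card_U : #|U| = (2 * k)%N) (card_H : #|H| = (4 * k)%N).
Hypotheses (card_gT : #|gT| = (8 * k)%N) (H_gen : <<[set x ^+ 2; t]>> = H).

Definition deza_set : {set gT} := (c *: U) :\ (t * c) :|: [set t; t * x; t * x * c].

Local Notation Z := deza_set.

Let cV : c^-1 = c. Proof. by apply/eqP; rewrite eq_invg_mul cc. Qed.
Let tV : t^-1 = t. Proof. by apply/eqP; rewrite eq_invg_mul tt. Qed.

Let c_neq1 : c != 1. Proof. by apply: contraNneq Uc => ->. Qed.

Let cU : c *: U = H :\: U.
Proof. by apply: index2_coset; rewrite // card_U card_H mulnAC. Qed.

Let Uc' g : g \in c *: U -> g \notin U.
Proof. by rewrite cU => /setDP[]. Qed.

Let oGH : #|[set: gT]%G| = (#|H| * 2)%N.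
Proof. by rewrite cardsT card_gT card_H mulnAC. Qed.

Let Hcoset g : g \notin H -> g *: H = ~: H.
Proof. by move=> Hg; rewrite (index2_coset (subsetT H)) ?setTD ?inE. Qed.

Let Hrcoset g : g \notin H -> H :* g = ~: H.
Proof. by move=> Hg; rewrite (index2_rcoset (subsetT H)) ?setTD ?inE. Qed.

Let H_index2 g h : g \notin H -> h \notin H -> g * h \in H.
Proof.
move=> Hg Hh; have : h \in g^-1 *: H by rewrite Hcoset ?groupV // inE.
by rewrite mem_lcoset invgK.
Qed.

Let Ht : t \in H. Proof. exact: subsetP sUH _ Ut. Qed.

Let tx_notin : t * x \notin H. Proof. by rewrite groupMl. Qed.

Let memZ g : (g \in Z) =
  (g \in c *: U) && (g != t * c) || (g \in [set t; t * x; t * x * c]).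
Proof. by rewrite [LHS]in_setU in_setD1 andbC. Qed.

(** The coset [cU] is [H] minus [U], while [tx] and [txc] lie outside [H]. *)
Let ZU g : g \in Z -> g \in U -> g = t.
Proof.
move=> + Ug; rewrite memZ => /orP[/andP[/Uc']|]; first by rewrite Ug.
have Hg := subsetP sUH _ Ug.
rewrite !inE -orbA => /or3P[/eqP-> //|/eqP def_g|/eqP def_g].
  by case/negP: tx_notin; rewrite -def_g.
by case/negP: tx_notin; rewrite -(groupMr _ Hc) -def_g.
Qed.

Let Zt : t \in Z. Proof. by rewrite memZ !inE eqxx orbT. Qed.

Let mem_cU g : (g \in c *: U) = (c * g \in U).
Proof. by rewrite mem_lcoset cV. Qed.

Let Zc : c \in Z.
Proof.
rewrite memZ mem_cU cc group1 /=.
rewrite -[X in X != _]mul1g (inj_eq (mulIg c)).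
by rewrite eq_sym t_neq1.
Qed.

Let tx_invol : (t * x) * (t * x) = 1.
Proof.
by rewrite -(mulgA t) (mulgA x) xt mulgKV tt.
Qed.

Let tc_V : (t * c)^-1 = t * c. Proof. by rewrite invMg tV cV c_central. Qed.

Let txV : (t * x)^-1 = t * x.
Proof. by apply/eqP; rewrite eq_invg_mul tx_invol. Qed.

Let connZ : connection_set Z.
Proof.
split.
  by apply/negP=> Z1; case/eqP: t_neq1; rewrite -(ZU Z1 (group1 U)).
have sub g : g \in Z -> g^-1 \in Z.
  rewrite !memZ !mem_cU => /orP[/andP[Ug g_tc]|set_g]; apply/orP; [left|right].
    by rewrite -groupV invMg invgK cV (c_central g) Ug -(inj_eq invg_inj) invgK tc_V.
  move: set_g; rewrite !inE -!orbA => /or3P[]/eqP->; rewrite ?tV ?txV ?eqxx ?orbT //.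
  by rewrite invMg txV cV -c_central eqxx !orbT.
apply/setP=> g; rewrite mem_invg; apply/idP/idP=> Zg; first exact: sub.
by rewrite -(invgK g); apply: sub.
Qed.

Let mulc_neq g : g * c != g.
Proof. by rewrite -[X in _ != X]mulg1 (inj_eq (mulgI g)). Qed.

Let txc_notin : t * x * c \notin H. Proof. by rewrite groupMr. Qed.

(** Exchanging [tc] for [t] contributes [t(1 - c)] and the pair outside [H] contributes [tx(1 + c)]:
    this is the shape required by [square_identity]. *)
Let Z_gsum : gsum Z = (gsum U * gsum [set c] + gsum [set t] * (1 - gsum [set c]) +
  gsum [set t * x]%g * (1 + gsum [set c]))%R.
Proof.
have tcU : t * c \in c *: U by rewrite mem_cU c_central mulgA cc mul1g Ut.
rewrite gsumU; last first.
  apply/pred0P=> g /=; apply/negP=> /andP[]; rewrite in_setD1 cU in_setD !inE -orbA.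
  case/and3P=> _ Ug Hg /or3P[]/eqP def_g; move: Ug Hg; rewrite def_g.
  - by rewrite Ut.
  - by rewrite (negPf tx_notin).
  - by rewrite (negPf txc_notin).
rewrite gsumD1 // gsumU; last first.
  rewrite disjoint_sym disjoints1 !inE negb_or mulc_neq andbT eq_sym.
  by apply: contraNneq txc_notin => <-.
rewrite gsum2; last by apply: contraNneq tx_notin => <-.
have -> : c *: U = U :* c by apply/setP=> g; rewrite mem_lcoset mem_rcoset cV c_central.
rewrite -gsum_mulCr -(gsum_mul11 t c) -(gsum_mul11 (t * x) c)
  mulrBr mulrDr !mulr1 !addrA.
by rewrite (addrAC _ (- _)%R).
Qed.

Local Open Scope ring_scope.

Let mulcc : gsum [set c] * gsum [set c] = 1. Proof. by rewrite gsum_mul11 cc. Qed.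
Let multt : gsum [set t] * gsum [set t] = 1. Proof. by rewrite gsum_mul11 tt. Qed.

Let mulc (X : {set gT}) : gsum X * gsum [set c] = gsum [set c] * gsum X.
Proof.
rewrite gsum_mulCr gsum_mulCl; congr gsum; apply/setP=> g.
by rewrite mem_lcoset mem_rcoset cV c_central.
Qed.

Let H_gsum : gsum U + gsum [set c] * gsum U = gsum H.
Proof.
rewrite gsum_mulCl -gsumU; last first.
  by apply/pred0P=> g /=; rewrite cU !inE; case: (g \in U).
by congr gsum; apply/esym/index2_cover; rewrite // card_U card_H mulnAC.
Qed.

Let Z_sqr : gsum Z * gsum Z =
  gsum U *+ (2 * k) - (gsum U - gsum (c *: U)%g) *+ 2 + gsum (~: H) *+ 2 + 4%:R.
Proof.
have -> : gsum U - gsum (c *: U)%g = gsum U * (1 - gsum [set c]).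
  by rewrite mulrBr mulr1 mulc gsum_mulCl.
have UC : gsum U * (1 + gsum [set c]) = gsum H by rewrite mulrDr mulr1 mulc H_gsum.
have CU : gsum U * gsum [set (t * x)%g] * (1 + gsum [set c]) = gsum (~: H).
  have Cs : (1 + gsum [set c]) * gsum [set (t * x)%g] =
      gsum [set (t * x)%g] * (1 + gsum [set c]).
    by rewrite mulrDr mulrDl mul1r mulr1 mulc.
  by rewrite -mulrA -Cs mulrA UC gsum_mulCr Hrcoset.
have sU : gsum [set (t * x)%g] * gsum U * (1 + gsum [set c]) = gsum (~: H).
  by rewrite -mulrA UC gsum_mulCl Hcoset.
have ss : gsum [set (t * x)%g] * gsum [set (t * x)%g] = 1 by rewrite gsum_mul11 tx_invol.
have uu : gsum U * gsum U = gsum U *+ (2 * k) by rewrite gsum_sqr_group card_U.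
have ut : gsum U * gsum [set t] = gsum U by rewrite gsum_mulCr rcoset_id ?Ut.
have tu : gsum [set t] * gsum U = gsum U by rewrite gsum_mulCl lcoset_id ?Ut.
rewrite Z_gsum.
exact: (square_identity (mulc U) (mulc [set t]) (mulc [set (t * x)%g])
  mulcc multt ss uu ut tu CU sU).
Qed.

Let Z_sqr_coef g : (gsum Z * gsum Z) g =
  (if g == 1%g then 2 * k + 2 else if g \in U then 2 * k - 2 else 2)%N%:Z.
Proof.
have one_coef : (1 : group_ring gT) g = (g == 1%g : nat)%:Z.
  by rewrite [LHS](gsumE [set 1%g]) inE.
rewrite Z_sqr !gr_addE !gr_oppE !gr_mulrnE !gr_addE gr_oppE one_coef !gsumE.
rewrite in_setC; apply: deza_coef_arith; first exact: leq_trans k_ge3.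
- by move/eqP->; apply: group1.
- by move=> Ug; rewrite cU inE Ug.
- rewrite cU inE; case: (boolP (g \in U)) => [/(subsetP sUH)-> // | _]; by [].
Qed.

(** * Deza property, failure of strong regularity, and diameter *)

Local Open Scope nat_scope.
Local Open Scope group_scope.

Let common_Z (u v : gT) : u != v ->
  common_nbrs (cay Z) u v = (if (v * u^-1)%g \in U then 2 * k - 2 else 2)%N.
Proof.
move=> u_v; apply/eqP; rewrite -eqz_nat common_nbrs_cay; last by case: connZ.
by rewrite Z_sqr_coef -eq_mulgV1 eq_sym [v == u]eq_sym (negPf u_v).
Qed.

Let common_Z1 v : v != 1 ->
  common_nbrs (cay Z) 1 v = (if v \in U then 2 * k - 2 else 2)%N.
Proof. by move=> v1; rewrite common_Z 1?eq_sym // invg1 mulg1. Qed.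

Let Z1 : 1 \notin Z. Proof. by case: connZ. Qed.

Let graphZ : is_graph (cay Z).
Proof.
have [_ symZ] := connZ; split=> [g h|g]; rewrite /cay !mem_rcoset; last first.
  by rewrite mulgV (negPf Z1).
by rewrite {1}symZ mem_invg invMg invgK.
Qed.

Let cay1 v : cay Z 1 v = (v \in Z). Proof. by rewrite /cay mulg1. Qed.

Let dezaZ : deza (cay Z).
Proof.
split; first exact: graphZ.
exists #|Z|, (2 * k - 2)%N, 2; split=> [v | u v u_v].
  by rewrite -(card_rcoset Z v); apply: eq_card => w; rewrite inE.
by rewrite common_Z //; case: ifP; [left | right].
Qed.

(** Both [t] and [c] are adjacent to [1], but they share [2k - 2] and [2] neighbours with it, and
    these numbers differ for [k >= 3]. *)
Let not_srgZ : ~ strongly_regular (cay Z).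
Proof.
move=> [_ [d [l [m [_ adj _]]]]].
have := adj 1 t; rewrite cay1 => /(_ Zt); rewrite common_Z1 // Ut.
have := adj 1 c; rewrite cay1 => /(_ Zc); rewrite common_Z1 // (negPf Uc) => <-.
apply/eqP; rewrite -(eqn_add2r 2) subnK ?(leq_mul2l 2 1) ?(ltnW (ltnW k_ge3)) //.
by rewrite gtn_eqF // (ltn_mul2l 2 2).
Qed.

Let Zx : x \notin Z.
Proof.
rewrite memZ !inE cU inE (negPf Hx) andbF /= -orbA; apply/norP; split.
  by apply: contraNneq Hx => ->.
rewrite -{1 3}[x]mul1g -mulgA (c_central x) (mulgA t) !(inj_eq (mulIg x)).
rewrite eq_sym (negPf t_neq1) /=; apply: contraNneq Uc => tc1.
by rewrite -(mulKg t c) -tc1 mulg1 groupV.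
Qed.

(** Both possible numbers of common neighbours are positive, so distinct vertices are at distance at
    most two; [1] and [x] attain it since [x] is not in [Z]. *)
Let diamZ : has_diameter (cay Z) 2.
Proof.
have no_walk0 u v : u != v -> ~ walk (cay Z) u v 0.
  by move=> /eqP u_v [p [_ + /size0nil p0]]; rewrite p0.
have no_walk1 u v : ~~ cay Z u v -> ~ walk (cay Z) u v 1.
  move=> /negP u_v [[|w [|? ?]] [+ + //]] => /=.
  by rewrite andbT => + def_v; rewrite def_v.
have walk2 u v : u != v -> walk (cay Z) u v 2.
  move=> u_v; have: 0 < common_nbrs (cay Z) u v.
    rewrite common_Z //; case: ifP => // _.
    by rewrite subn_gt0 (ltn_mul2l 2 1) (ltnW k_ge3).
  case/card_gt0P=> w; rewrite inE => /andP[uw vw].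
  by exists [:: w; v]; rewrite /= uw (proj1 graphZ) vw.
have dist2 u v : u != v -> ~~ cay Z u v -> distance (cay Z) u v 2.
  move=> u_v not_uv; split; first exact: walk2.
  by case=> [/(no_walk0 _ _ u_v) | [/(no_walk1 _ _ not_uv) |]].
split=> [u v|]; last first.
  exists 1, x; apply: dist2; last by rewrite cay1.
  by apply: contraNneq Hx => <-.
have [-> | u_v] := eqVneq u v.
  by exists 0 => //; split=> //; exists [::].
have [uv | not_uv] := boolP (cay Z u v); last by exists 2; first exact: dist2.
exists 1%N => //; split; first by exists [:: v]; rewrite /= uv.
by case=> // /(no_walk0 _ _ u_v).
Qed.

(** * The WL-closure of the connection set *)

Let pairE g : gsum [set g; g * c] = (gsum [set g] * (1 + gsum [set c]))%R.
Proof. by rewrite gsum2 1?eq_sym ?mulc_neq // -gsum_mul11 mulrDr mulr1. Qed.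

Let sqr_x : (gsum [set x; x * c]%g * gsum [set x; x * c]%g =
  gsum [set x ^+ 2; x ^+ 2 * c]%g *+ 2)%R.
Proof.
rewrite !pairE -gsum_mul11.
have px : ((1 + gsum [set c]) * gsum [set x] = gsum [set x] * (1 + gsum [set c]))%R.
  by rewrite mulrDr mulrDl mul1r mulr1 mulc.
have pp : ((1 + gsum [set c]) * (1 + gsum [set c]) = (1 + gsum [set c]) *+ 2)%R.
  by rewrite [LHS]mulrDl mul1r mulrDr mulr1 mulcc [X in (_ + X)%R]addrC.
by rewrite mulrA -[X in (X * _)%R = _]mulrA px mulrA -[LHS]mulrA pp mulrnAr.
Qed.

(** The summands [Uc] and [t(1 - c)] commute with [t] and cancel. The rest is [t(tx) = x] against
    [(tx)t = x^-1], each times [1 + c]. *)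
Let diff_tZ : (gsum [set t] * gsum Z - gsum Z * gsum [set t] =
  gsum [set x; x * c]%g - gsum [set x^-1; x^-1 * c]%g)%R.
Proof.
have txt : t * x * t = x^-1 by rewrite -mulgA xt mulgA tt mul1g.
have ut : (gsum U * gsum [set t] = gsum U)%R by rewrite gsum_mulCr rcoset_id.
have tu : (gsum [set t] * gsum U = gsum U)%R by rewrite gsum_mulCl lcoset_id.
have -> : (gsum [set t] * gsum Z =
    gsum U * gsum [set c] + (1 - gsum [set c]) + gsum [set x; x * c]%g)%R.
  by rewrite Z_gsum pairE 2!mulrDr !mulrA tu multt mul1r gsum_mul11 mulgA tt mul1g.
have -> : (gsum Z * gsum [set t] =
    gsum U * gsum [set c] + (1 - gsum [set c]) + gsum [set x^-1; x^-1 * c]%g)%R.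
  rewrite Z_gsum pairE !mulrDl -!mulrA -mulc (mulrA (gsum U)) ut.
  congr (_ + _ + _)%R.
    by rewrite mulrBl mulrBr mul1r -mulc !mulrA multt mul1r.
  by rewrite mulrDl mul1r -mulc mulrDr mulrA gsum_mul11 txt mulrDr mulr1.
by rewrite opprD addrACA subrr add0r.
Qed.

Let wlZ : wl_closure Z (twist_partition H c).
Proof.
split.
- exact: twist_partition_sring.
(* Outside [H] the set [Z] consists of [tx] and [txc], which [twist] swaps. *)
- apply: union_of_basic_twist => // g; rewrite /twist; case: ifP => // Hg.
  rewrite !memZ cU inE Hg andbF /= !inE -!orbA => /or3P[]/eqP def_g.
  + by rewrite def_g Ht in Hg.
  + by rewrite def_g eqxx !orbT.
  + by rewrite def_g -mulgA cc mulg1 eqxx !orbT.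
move=> Q Q_sring QZ.
have Q_Z := sring_union Q_sring QZ.
(* By [ZU] the other elements of [Z] lie outside [U], where the square has coefficient 2, and
   [2k - 2] exceeds 2. *)
have Q_t : zspan Q (gsum [set t]).
  apply: (sring_level Q_sring Q_Z (sringM Q_sring Q_Z Q_Z)
    (m := 1) (n := Posz (2 * k - 2))).
  move=> g; rewrite inE Z_sqr_coef gsumE; apply/eqP/idP => [->|].
    by rewrite Zt (negPf t_neq1) Ut /=.
  case: (boolP (g \in Z)) => // Zg /=.
  have -> : (g == 1) = false by apply: contraNF Z1 => /eqP <-.
  case: (boolP (g \in U)) => [Ug _|_]; first exact: ZU.
  rewrite eqz_nat ltn_eqF // -(ltn_add2r 2) subnK ?(ltn_mul2l 2 2) //.
  by rewrite (leq_mul2l 2 1) (ltnW (ltnW k_ge3)).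
have Q_x : zspan Q (gsum [set x; x * c]).
  have := sringB Q_sring (sringM Q_sring Q_t Q_Z) (sringM Q_sring Q_Z Q_t).
  rewrite diff_tZ => Q_d.
  (* The pair is the set where the difference has coefficient 1, so one element serves for both
     levels. *)
  apply: (sring_level Q_sring Q_d Q_d (m := 1) (n := 1)) => g.
  rewrite andbb gr_addE gr_oppE !gsumE.
  case: (boolP (g \in [set x; x * c])) => [gx|_]; last by case: (g \in _).
  (* A common element of the two pairs would force [x^2] to be [1] or [c]. *)
  suff /negPf-> : g \notin [set x^-1; x^-1 * c] by [].
  apply/negP=> gx'.
  have xg : x * g = x ^+ 2 \/ x * g = x ^+ 2 * c.
    by case/set2P: gx => ->; [left | right; rewrite mulgA].
  have xg' : x * g = 1 \/ x * g = c.
    by case/set2P: gx' => ->; [left; rewrite mulgV | right; rewrite mulKVg].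
  case: xg' xg => -> [] x2; move: x2_neq1 x2_c.
  - by rewrite -x2 eqxx.
  - by rewrite -[x ^+ 2](mulgK c) -x2 mul1g cV eqxx.
  - by rewrite -x2 eqxx.
  - by rewrite -[x ^+ 2](mulgK c) -x2 mulgV eqxx.
(* Since [c * x^2] is in [U], [x^2] is in [cU] and differs from [tc], so it lies in [Z]. Its partner
   [x^2 * c] lies in [U], hence could be in [Z] only as [t], which [x2_tc] excludes. *)
have Q_x2 : zspan Q (gsum [set x ^+ 2]).
  apply: (sring_level Q_sring Q_Z (sringM Q_sring Q_x Q_x) (m := 1) (n := 2)) => g.
  rewrite sqr_x gr_mulrnE !gsumE inE; apply/eqP/idP => [->|].
    by rewrite set21 memZ mem_cU cx2 x2_tc.
  case: (boolP (g \in Z)) => // Zg /=.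
  case: (boolP (g \in [set _; _])) => // /set2P[] // def_g _.
  case/eqP: x2_tc; apply: (mulIg c); rewrite -(mulgA t) cc mulg1 -def_g.
  by apply: ZU; rewrite // def_g (c_central (x ^+ 2)).
have Q_H h : h \in H -> zspan Q (gsum [set h]).
  by rewrite -H_gen; apply: (sring_gen1 Q_sring) => i /set2P[]->.
exact: (twist_minimal cc Hc H_index2 Q_sring Q_H Hx Q_x).
Qed.

Lemma deza_setP :
  [/\ connection_set Z, strictly_deza (cay Z) & wl_rank Z (6 * k)].
Proof.
split; [exact: connZ | by split | exists (twist_partition H c) => //].
(* Twice the number of orbits is [8k + 4k]. *)
apply/eqP; rewrite -(eqn_pmul2r (isT : 0 < 2)); apply/eqP.
rewrite (card_twist_partition cc Hc c_neq1) card_gT card_H.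
by rewrite -mulnDl mulnAC.
Qed.

End DezaSet.

(** * Realization inside the dihedral group of order [8k] *)

Section DihedralCayley.

Local Open Scope group_scope.

Variables (k : nat) (gT : finGroupType) (x y : gT).
Hypotheses (k_ge3 : 2 < k) (k_odd : odd k).
Hypothesis xy_gen : dihedral_generators (4 * k) x y.

Let c := x ^+ (2 * k).
Let t := y * x ^- 2.

Let card_gT : #|gT| = (8 * k)%N.
Proof. by rewrite (card_dihedral_generators _ xy_gen); lia. Qed.

Let genG : <<[set x; y]>> = [set: gT]. Proof. by case: xy_gen. Qed.
Let xn : x ^+ (4 * k) = 1. Proof. by case: xy_gen. Qed.
Let yy : y * y = 1. Proof. by case: xy_gen. Qed.
Let yV : y^-1 = y. Proof. by apply/eqP; rewrite eq_invg_mul yy. Qed.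
Let xJy : x ^ y = x^-1.
Proof. by case: xy_gen => _ _ _ _ <-; rewrite conjgE yV mulgA. Qed.

(** The relation only bounds the order above. Since [y] normalizes [<[x]>], the group is [<[x]> *
    <[y]>] with [#[y] <= 2], and its order [8k] gives the lower bound. *)
Let order_x : #[x] = (4 * k)%N.
Proof.
apply/eqP; rewrite eqn_leq dvdn_leq ?order_dvdn ?xn //=; last by lia.
have: #|gT| <= #[x] * 2.
  rewrite -cardsT -genG -joingE -[_ <*> _]joing_idl -[_ <*> _]joing_idr.
  rewrite norm_joinEr; last first.
    by rewrite cycle_subG; apply/normP; rewrite -cycleJ xJy cycleV.
  rewrite -(leq_pmul2r (cardG_gt0 (<[x]> :&: <[y]>))) -mul_cardG -mulnA.
  rewrite leq_mul2l; apply/orP; right.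
  have oy : #[y] <= 2 by rewrite dvdn_leq // order_dvdn; apply/eqP/yy.
  by rewrite (leq_trans oy) // leq_pmulr.
by rewrite card_gT; lia.
Qed.

Let y_notin : y \notin <[x]>.
Proof.
apply/negP=> x_y; have: #|gT| <= #|<[x]>|.
  by rewrite -cardsT -genG subset_leq_card // gen_subG subUset !sub1set cycle_id.
by rewrite -orderE order_x card_gT; lia.
Qed.

Let expx_eq1 m : (x ^+ m == 1) = (4 * k %| m).
Proof. by rewrite -order_dvdn order_x. Qed.

Let t_notin : t \notin <[x]>.
Proof. by rewrite /t groupMr // groupV mem_cycle. Qed.

Let tJ m : (x ^+ m) ^ t = x ^- m.
Proof.
rewrite /t conjgM conjXg xJy expgVn; apply/conjg_fixP/commgP.
by apply/commuteV/commute_sym/commuteV; rewrite /commute -!expgD addnC.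
Qed.

Let tt : t * t = 1.
Proof.
have yx2 : y * x ^- 2 * y = x ^- 2 ^ y by rewrite conjgE yV mulgA.
by rewrite /t mulgA yx2 conjVg conjXg xJy expgVn invgK mulgV.
Qed.

Let xt : x * t = t * x^-1. Proof. by rewrite conjgC (tJ 1). Qed.

Let cc : c * c = 1. Proof. by rewrite -expgD addnn -mul2n mulnA xn. Qed.

Let cV : c^-1 = c. Proof. by apply/eqP; rewrite eq_invg_mul cc. Qed.

Let c_central g : g * c = c * g.
Proof.
have /subsetP/(_ g (in_setT g)) : [set: gT] \subset 'C[c]; last by move/cent1P.
rewrite -genG gen_subG subUset !sub1set; apply/andP; split; apply/cent1P.
  by rewrite /commute -expgSr -expgS.
by rewrite /commute [RHS]conjgC conjXg xJy expgVn cV.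
Qed.

(** One family covers both [U = D 4] and [H = D 2]; the order is [8k / i] when [i] divides [4k]. *)
Let D i : {group gT} := <[x ^+ i]> <*> <[t]>.

Let D_mulE i : D i = <[x ^+ i]> * <[t]> :> {set gT}.
Proof.
rewrite /D /= norm_joinEr // cycle_subG; apply/normP.
by rewrite -cycleJ tJ cycleV.
Qed.

Let cycle_t g : g \in <[t]> -> g = 1 \/ g = t.
Proof.
have o2 : t ^+ 2 = 1 by [].
by move=> /cycleP[m ->]; rewrite -(expg_mod _ o2) modn2; case: (odd m); [right | left].
Qed.

(** Exponents of [x] matter modulo [4k], which preserves divisibility by a divisor [i] of [4k]. The
    coset of [t] contains no power of [x]. *)
Let mem_D i m : i %| 4 * k -> (x ^+ m \in D i) = (i %| m).
Proof.
move=> i_dvd; rewrite D_mulE; apply/idP/idP => [|/dvdnP[j ->]]; last first.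
  by rewrite mulnC expgM -[_ ^+ j]mulg1 mem_mulg ?mem_cycle.
case/mulsgP=> _ g /cycleP[j ->] /cycle_t[] ->.
  rewrite mulg1 -expgM => /eqP; rewrite eq_expg_mod_order order_x => /eqP eq_m.
  have := dvdn_mulr j (dvdnn i); rewrite (divn_eq (i * j) (4 * k)) -eq_m.
  rewrite dvdn_addr; last exact: dvdn_mull.
  by rewrite /dvdn modn_dvdm.
move=> def_t; case/negP: t_notin.
by rewrite -(mulKg (x ^+ i ^+ j) t) -def_t groupM ?groupV ?mem_cycle // -expgM mem_cycle.
Qed.

Let mem_D_t i : t \in D i.
Proof. by rewrite mem_gen // inE cycle_id orbT. Qed.

Let mem_D_x i m : i %| 4 * k -> i %| m -> x ^+ m \in D i.
Proof. by move=> i_dvd; rewrite mem_D. Qed.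

Let card_t : #[t] = 2.
Proof.
apply/nt_prime_order => //.
by apply: contraNneq t_notin => ->.
Qed.

Let card_D i j : (i * j = 4 * k)%N -> #|D i| = (j * 2)%N.
Proof.
move=> ij; have i_gt0 : 0 < i by case: i ij => //; lia.
rewrite D_mulE TI_cardMg -?orderE ?card_t.
  by rewrite orderXdiv order_x -ij ?dvdn_mulr ?mulKn.
apply/trivgP/subsetP => g /setIP[xg /cycle_t[->|def_g]]; first exact: group1.
by case/negP: t_notin; rewrite -def_g; apply: subsetP xg; rewrite cycle_subG mem_cycle.
Qed.

Let d4 : 4 %| 4 * k. Proof. exact: dvdn_mulr. Qed.
Let d2 : 2 %| 4 * k. Proof. exact: dvdn_mulr. Qed.

Let A := <[x ^+ 4]>%G.
Let U := D 4.
Let H := D 2.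
Let Z := sigma_set k x y.

Let sUH : U \subset H.
Proof.
rewrite /U /H /D /= join_subG joing_subr andbT cycle_subG.
by apply: (mem_D_x d2).
Qed.

Let card_U : #|U| = (2 * k)%N. Proof. by rewrite (card_D (erefl (4 * k)%N)) mulnC. Qed.
Let card_H : #|H| = (4 * k)%N.
Proof. by rewrite (@card_D 2 (2 * k)) ?mulnA // mulnAC. Qed.

Let Hc : c \in H. Proof. by apply: (mem_D_x d2); apply: dvdn_mulr. Qed.
(** Oddness of [k] enters here: 4 does not divide [2k]. *)
Let Uc : c \notin U.
Proof. by rewrite (mem_D _ d4) [_ %| _](@dvdn_pmul2l 2 2 k isT) dvdn2 k_odd. Qed.
Let Hx : x \notin H. Proof. by rewrite -[x]expg1 (mem_D _ d2). Qed.

(** Everything follows from [y = t * x^2]: the three extra elements become [txc], [t], [tx], the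
    deleted one becomes [tc], and [x^2 A], [yA] become [cA], [ctA]. *)
Let Z_E : Z = (c *: U) :\ (t * c) :|: [set t; t * x; t * x * c].
Proof.
have U_E : U = A :|: t *: A :> {set gT}.
  apply: index2_cover; rewrite ?joing_subl ?mem_D_t //.
    by apply: contra t_notin; apply/subsetP; rewrite cycle_subG mem_cycle.
  by rewrite card_U -orderE orderXdiv order_x ?mulKn // mulnC.
have yt : y = t * x ^+ 2 by rewrite /t mulgKV.
have -> : [set t; t * x; t * x * c] =
    [set y * x ^+ (2 * k - 1)%N; y * x ^- 2; y * x^-1].
  have -> : y * x^-1 = t * x by rewrite yt -mulgA expgS expg1 mulgK.
  have -> : y * x ^+ (2 * k - 1)%N = t * x * c.
    rewrite yt -[LHS]mulgA -[RHS]mulgA; congr (t * _).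
    by rewrite -expgD -expgS; congr (x ^+ _); move: k_ge3; clear; lia.
  by apply/setP=> g; rewrite !inE orbC orbA.
rewrite /Z /sigma_set; congr (_ :|: _).
have x2A : x ^+ 2 *: A = c *: A.
  apply/lcoset_eqP; rewrite mem_lcoset cV -expgD.
  (* As [k] is odd, [2k + 2] is a multiple of 4, so [x^2] and [c] define the same coset of [A]. *)
  have -> : (2 * k + 2 = 4 * (k.+1./2))%N by move: k_odd; clear; lia.
  by rewrite expgM mem_cycle.
have yA : y *: A = c *: (t *: A).
  by rewrite yt lcosetM x2A -!lcosetM c_central.
have yu : y * x ^+ (2 * (k - 1)) = t * c.
  rewrite yt -[LHS]mulgA; congr (t * _).
  by rewrite -expgD; congr (x ^+ _); move: k_ge3; clear; lia.
rewrite U_E mulgU -x2A -yA; apply/setP=> g; rewrite !inE !mem_lcoset !inE.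
rewrite -yu (can2_eq (mulKVg y) (mulKg y)).
case: eqP => [->|_] /=; last by [].
(* Deleting [tc] from [yA] alone or from the whole union is the same, because [tc] is not a power of
   [x] and so avoids [x^2 A]. *)
rewrite orbF yu; apply/negbTE/negP => /cycleP[m]; rewrite -expgM => def_m.
case/negP: t_notin.
rewrite -(groupMr t (mem_cycle x (2 * k))) -(mulKVg (x ^+ 2) (t * _)) def_m.
by rewrite groupM ?mem_cycle.
Qed.

Let H_gen : <<[set x ^+ 2; t]>> = H.
Proof. by rewrite /H /D /= joing_idl joing_idr. Qed.

Let cx2 : c * x ^+ 2 \in U.
Proof.
have -> : c * x ^+ 2 = x ^+ (2 * (k + 1)) by rewrite -expgD mulnDr.
rewrite (mem_D _ d4).
by rewrite [_ %| _](@dvdn_pmul2l 2 2 (k + 1) isT) dvdn2 oddD k_odd.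
Qed.

Let x2_neq1 : x ^+ 2 != 1.
Proof. by rewrite expx_eq1 gtnNdvd //; move: k_ge3; clear; lia. Qed.

Let x2_c : x ^+ 2 != c.
Proof.
by rewrite eq_expg_mod_order order_x !modn_small; move: k_ge3; clear; lia.
Qed.

Let x2_tc : x ^+ 2 != t * c.
Proof.
apply: contraNneq t_notin => x2; rewrite -(groupMr t (mem_cycle x (2 * k))).
by rewrite -[_ * _]x2 mem_cycle.
Qed.

Let t_neq1 : t != 1. Proof. by apply: contraNneq t_notin => ->. Qed.

Lemma sigma_setP :
  [/\ connection_set Z, strictly_deza (cay Z) & wl_rank Z (6 * k)].
Proof.
rewrite Z_E.
apply: (@deza_setP k gT U H c t x) => //; exact: mem_D_t.
Qed.

End DihedralCayley.

(** * The explicit dihedrant and the existence of a suitable group *)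

Lemma sigma_set_dihedrant (k : nat) (gT : finGroupType) (x y : gT) :
    2 < k -> odd k -> dihedral_generators (4 * k) x y ->
  let Z := sigma_set k x y in
  [/\ connection_set Z, dihedrant (cay Z), #|gT| = 8 * k,
      strictly_deza (cay Z) & wl_rank Z (6 * k)].
Proof.
move=> k_ge3 k_odd xy_gen Z; have [connZ dezaZ wlZ] := sigma_setP k_ge3 k_odd xy_gen.
have k_gt0 : 0 < k := ltn_trans (isT : 0 < 2) k_ge3.
split=> //; last first.
  have n_gt1 : 1 < 4 * k := leq_mul (isT : 1 < 4) k_gt0.
  by rewrite (card_dihedral_generators n_gt1 xy_gen) -mul2n mulnA.
exists gT, Z; split=> //; last by exists id => //; exists id.
by exists (4 * k), x, y; rewrite muln_gt0.
Qed.

Theorem theorem1p3 (k : nat) (k_ge3 : 3 <= k) (k_odd : odd k) :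
  (exists (gT : finGroupType) (S : {set gT}),
     [/\ connection_set S, dihedrant (cay S), #|gT| = 8 * k,
         strictly_deza (cay S) & wl_rank S (6 * k)]) /\
  (forall (gT : finGroupType) (x y : gT), dihedral_generators (4 * k) x y ->
     let Z := sigma_set k x y in
     [/\ connection_set Z, dihedrant (cay Z), #|gT| = 8 * k,
         strictly_deza (cay Z) & wl_rank Z (6 * k)]).
Proof.
split=> [|gT x y xy_gen]; last exact: sigma_set_dihedrant.
have n_gt1 : 1 < 4 * k := leq_mul (isT : 1 < 4) (ltn_trans (isT : 0 < 2) k_ge3).
(* The library dihedral group of order [8k] supplies the generators. *)
have [gT [x [y xy_gen]]] := exists_dihedral_generators n_gt1.
by exists gT, (sigma_set k x y); apply: sigma_set_dihedrant.
Qed.
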